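(* For every integer $\ell \geq 2$ there is a constant $C > 0$ such that \[ f(r, C_{2\ell}) \leq C\, r^{\frac{3\ell-2}{3\ell+2}} (\log r)^{\frac{3\ell}{3\ell+2}} \] for infinitely many positive integers $r$.
   Context: Let $r,k$ be positive integers. A graph $G$ is an $(r,k)$-graph if $V(G)$ can be partitioned into sets $V_1,\dots,V_r$ with $|V_i| \le k$ for all $i$ such that for every pair $i \neq j$ in $[r]$ there is an edge of $G$ with one endpoint in $V_i$ and the other in $V_j$. For a graph $H$, $f(r,H)$ is the minimum $k$ such that there exists an $H$-free $(r,k)$-graph. $C_{2\ell}$ denotes the cycle of length $2\ell$. *)

(* Defs.v *)
From mathcomp Require Import all_boot.
From mathcomp Require Import boolp.

Set Implicit Arguments.
Unset Strict Implicit.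
Unset Printing Implicit Defensive.

Record sgraph := SGraph {
  vertex :> finType;
  edge : rel vertex;
  edge_sym : symmetric edge;
  edge_irr : irreflexive edge }.

(* Not necessarily induced subgraph containment. *)
Definition contains (G H : sgraph) : Prop :=
  exists h : H -> G, injective h /\ forall x y, edge x y -> edge (h x) (h y).

Definition free (H G : sgraph) : Prop := ~ contains G H.

Section Cycle.
Variable n : nat.

Definition cycle_rel : rel 'I_n :=
  fun x y => (x != y) && ((ordS x == y) || (ordS y == x)).

Lemma cycle_rel_sym : symmetric cycle_rel.
Proof. by move=> x y; rewrite /cycle_rel eq_sym orbC. Qed.

Lemma cycle_rel_irr : irreflexive cycle_rel.
Proof. by move=> x; rewrite /cycle_rel eqxx. Qed.

(* The cycle of length n when n >= 3. *)
Definition cycle_graph : sgraph := SGraph cycle_rel_sym cycle_rel_irr.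
End Cycle.

(* The parts of a [partition] are nonempty, as the edge condition forces
   anyway as soon as r >= 2. *)
Definition rk_graph (r k : nat) (G : sgraph) : Prop :=
  exists P : {set {set G}},
    [/\ partition P [set: G], #|P| = r,
        forall A, A \in P -> #|A| <= k &
        forall A B, A \in P -> B \in P -> A != B ->
          exists x y, [/\ x \in A, y \in B & edge x y]].

Definition free_rk (r k : nat) (H : sgraph) : Prop :=
  0 < k /\ exists G : sgraph, rk_graph r k G /\ free H G.

Lemma ex_free_rkb r H : (exists k, free_rk r k H) -> exists k, `[< free_rk r k H >].
Proof. by case=> k /asboolP; exists k. Qed.

(* The minimum k such that free_rk r k H; the default value 0 is only used when
   there is no such k, which [fP] below rules out for cycles. *)
Definition f (r : nat) (H : sgraph) : nat :=
  if pselect (exists k, free_rk r k H) is left ex then ex_minn (ex_free_rkb ex)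
  else 0.

(* The matching joining (i, j) to (j, i) for i <> j, with parts indexed by the
   first coordinate, has no cycle. *)
Section Matching.
Variable r : nat.

Definition matching_rel : rel ('I_r * 'I_r) :=
  fun u v => (u != v) && (v == (u.2, u.1)).

Lemma matching_rel_sym : symmetric matching_rel.
Proof.
move=> [a b] [c d]; rewrite /matching_rel eq_sym /= !xpair_eqE.
by congr andb; apply/andP/andP => -[/eqP-> /eqP->].
Qed.

Lemma matching_rel_irr : irreflexive matching_rel.
Proof. by move=> x; rewrite /matching_rel eqxx. Qed.

Definition matching : sgraph := SGraph matching_rel_sym matching_rel_irr.

Definition row_part (i : 'I_r) : {set matching} := [set u | u.1 == i].

Lemma matching_rk : rk_graph r r matching.
Proof.
have inj : injective row_part.
  by move=> i j /setP /(_ (i, i)); rewrite !inE eqxx => /esym/eqP.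
exists [set row_part i | i : 'I_r]; split.
- apply/and3P; split.
  + rewrite eqEsubset subsetT /=; apply/subsetP => u _; apply/bigcupP.
    by exists (row_part u.1); rewrite ?imset_f ?inE.
  + apply/trivIsetP => _ _ /imsetP[i _ ->] /imsetP[j _ ->] nij.
    rewrite -setI_eq0; apply/eqP/setP => u; rewrite !inE.
    by apply/negP => /andP[/eqP ui /eqP uj]; rewrite -ui -uj eqxx in nij.
  + apply/imsetP => -[i _ /setP /(_ (i, i))]; by rewrite !inE eqxx.
- by rewrite card_imset // card_ord.
- move=> _ /imsetP[i _ ->].
  have -> : row_part i = [set (i, j) | j : 'I_r] :> {set 'I_r * 'I_r}.
    apply/setP => -[a b]; rewrite inE /=; apply/eqP/imsetP => [->|[j _ [-> _]] //].
    by exists b.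
  by rewrite (leq_trans (leq_imset_card _ _)) // card_ord.
- move=> _ _ /imsetP[i _ ->] /imsetP[j _ ->] nij.
  exists (i, j), (j, i); rewrite !inE !eqxx; split=> //.
  rewrite /edge /= /matching_rel /= eqxx andbT xpair_eqE.
  by apply: contraNN nij => /andP[/eqP->].
Qed.

Lemma matching_free n : 2 < n -> free (cycle_graph n) matching.
Proof.
case: n => [|n] // n2 [h [h_inj h_hom]].
have n0 : 0 < n.+1 by [].
have n1 : 1 < n.+1 by apply: ltnW.
have E (i : nat) (a : i < n.+1) (b : i.+1 < n.+1) :
    @edge (cycle_graph n.+1) (Ordinal a) (Ordinal b).
  rewrite /edge /= /cycle_rel -!val_eqE /= modn_small // eqxx andbT.
  by rewrite neq_ltn ltnSn.
have /h_hom := E 0 n0 n1; rewrite edge_sym => /andP[_ /eqP e1].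
have /h_hom /andP[_ /eqP e2] := E 1 n1 n2.
by have /h_inj/(congr1 val) := etrans e1 (esym e2).
Qed.
End Matching.

Lemma fP r n : 0 < r -> 2 < n ->
  free_rk r (f r (cycle_graph n)) (cycle_graph n) /\
  forall k, free_rk r k (cycle_graph n) -> f r (cycle_graph n) <= k.
Proof.
move=> r0 n2; rewrite /f; case: pselect => [ex|[]]; last first.
  exists r; split=> //; exists (matching r).
  by split; [exact: matching_rk | exact: matching_free].
case: ex_minnP => k /asboolP Pk kmin; split=> // m Pm.
by apply: kmin; apply/asboolP.
Qed.

(* Main.v *)
(* Let s = l./2, q a prime and F = F_q.  In SL_2(F[t]/(t^(s+1))) take the subgroups
   A = {[[1, a], [0, 1]]} and B = {[[1, 0], [b t, 1]]}; the bipartite graph whose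
   vertices are their left cosets in the group of matrices upper unitriangular
   modulo t, adjacent when they meet, is q-regular with about q^(3s) <= q^(3l/2)
   vertices on each side.  A cycle of length 2l is a relation
   b_1 a_1 ... b_l a_l = 1 with nontrivial factors.  Cut into two halves it equates
   two alternating products of length l, one starting in A and the other in B,
   whose first rows, as polynomials in t, have different degrees, all at most s:
   so the graph has no such cycle.

   The coefficient of t in the lower left entry is constant on cosets of A, and
   cosets of A with the same value have disjoint neighbourhoods.  So the cosets of A
   can be cut into r sets of k elements having exactly k q neighbours each.  A
   random balanced partition of the cosets of B into r parts then meets each of
   these neighbourhoods as soon as k q / r > 2 ln r, and r ~ N / k with
   N = q^(3s) gives the exponents. *)
Require Import Defs.
From mathcomp Require Import all_boot all_order all_algebra.
From mathcomp Require Import reals sequences exp.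
From mathcomp Require Import zify ring lra.
Import Order.TTheory GRing.Theory Num.Theory.
Set Implicit Arguments.
Unset Strict Implicit.
Unset Printing Implicit Defensive.
Local Open Scope ring_scope.

(** * Bipartite graphs and random partitions *)

Section Bipartite.
Variables (P L : finType) (inc : P -> L -> bool).

Definition bip_rel : rel (P + L) := fun u v =>
  match u, v with
  | inl p, inr y | inr y, inl p => inc p y
  | _, _ => false
  end.

Lemma bip_rel_sym : symmetric bip_rel.
Proof. by case=> u [] v. Qed.

Lemma bip_rel_irr : irreflexive bip_rel.
Proof. by case. Qed.

Definition bip : sgraph := SGraph bip_rel_sym bip_rel_irr.

(** Winding around the cycle gives a periodic walk indexed by [nat], whose vertices alternate
    between the two sides. As 2l >= 4, positions two apart differ modulo 2l, so injectivity forbids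
    backtracking; only the closed non-backtracking walk is retained. *)
Lemma bip_cycle l : (2 <= l)%N -> contains bip (cycle_graph (2 * l)) ->
  exists (p : nat -> P) (y : nat -> L),
    [/\ forall i, inc (p i) (y i), forall i, inc (p i.+1) (y i),
        forall i, p i != p i.+1, forall i, y i != y i.+1
      & p l = p 0%N /\ y l = y 0%N].
Proof.
move=> l2 [h [h_inj h_hom]].
have l0 n : (n %% (2 * l) < 2 * l)%N by rewrite ltn_mod; lia.
pose w n : P + L := h (Ordinal (l0 n)).
have w_edge n : bip_rel (w n) (w n.+1).
  apply: h_hom; rewrite /edge /= /cycle_rel -!val_eqE /=.
  have -> : ((n %% (2 * l)).+1 %% (2 * l) = n.+1 %% (2 * l))%N.
    by rewrite -addn1 modnDml addn1.
  rewrite eqxx andbT -[X in (X %% _ != _)%N]addn0 -(addn1 n) eqn_modDl !modn_small; lia.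
have w_neq n : w n != w n.+2.
  apply/negP => /eqP /h_inj /(congr1 val) /= /eqP.
  rewrite -[X in (X %% _ == _)%N]addn0 -(addn2 n) eqn_modDl !modn_small; lia.
have w_per n : w (n + 2 * l)%N = w n.
  by congr h; apply: val_inj; rewrite /= modnDr.
(* The offset [d] is 0 or 1: it makes the walk start on the side of [P]. *)
have [d wd] : exists d, forall n, exists p y,
    w (d + 2 * n)%N = inl p /\ w (d + 2 * n).+1 = inr y.
  have step n p : w n = inl p -> exists y q, w n.+1 = inr y /\ w n.+2 = inl q.
    move=> wn; have := w_edge n; have := w_edge n.+1; rewrite wn.
    case: (w n.+1) => // y; case: (w n.+2) => // q _ _; by exists y, q.
  have [d [p wd]] : exists d p, w d = inl p.
    case E: (w 0%N) => [p|y]; first by exists 0%N, p.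
    by have := w_edge 0%N; rewrite E; case E1: (w 1%N) => [p|] // _; exists 1%N, p.
  exists d => n.
  have [q wn] : exists q, w (d + 2 * n)%N = inl q.
    elim: n => [|n [q /step [_ [q' [_ wn]]]]]; first by exists p; rewrite addn0.
    by exists q'; rewrite -wn; congr w; lia.
  by exists q; have [y [_ [wy _]]] := step _ _ wn; exists y.
have [p0 [y0 _]] := wd 0%N.
pose p n := if w (d + 2 * n)%N is inl p then p else p0.
pose y n := if w (d + 2 * n).+1 is inr y then y else y0.
have wp n : w (d + 2 * n)%N = inl (p n).
  by rewrite /p; have [? [? [-> _]]] := wd n.
have wy n : w (d + 2 * n).+1 = inr (y n).
  by rewrite /y; have [? [? [_ ->]]] := wd n.
have shift n : (d + 2 * n.+1 = (d + 2 * n).+2)%N by lia.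
exists p, y; split=> [i|i|i|i|].
- by have := w_edge (d + 2 * i)%N; rewrite wp wy.
- by have := w_edge (d + 2 * i).+1; rewrite -shift wp wy.
- by have := w_neq (d + 2 * i)%N; rewrite -shift !wp.
- by have := w_neq (d + 2 * i).+1; rewrite -shift !wy.
- split.
    by have := w_per (d + 2 * 0)%N; rewrite muln0 addn0 wp -[in w d](addn0 d) -(muln0 2) wp => -[].
  have := w_per (d + 2 * 0).+1; rewrite wy addSn muln0 addn0 wy => -[] //.
Qed.

End Bipartite.

Lemma coloring_rk_graph (G : sgraph) r k (col : G -> 'I_r) :
  (forall i, exists x, col x = i) ->
  (forall i, #|[set x | col x == i]| <= k)%N ->
  (forall i j, i != j -> exists x y, [/\ col x = i, col y = j & edge x y]) ->
  rk_graph r k G.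
Proof.
move=> col_surj col_card col_edge.
pose part i : {set G} := [set x | col x == i].
have part_inj : injective part.
  move=> i j; have [x <-] := col_surj i.
  by move=> /setP /(_ x); rewrite !inE eqxx => /esym/eqP.
exists [set part i | i : 'I_r]; split.
- apply/and3P; split.
  + rewrite eqEsubset subsetT /=; apply/subsetP => x _; apply/bigcupP.
    by exists (part (col x)); rewrite ?imset_f ?inE.
  + apply/trivIsetP => _ _ /imsetP[i _ ->] /imsetP[j _ ->] nij.
    rewrite -setI_eq0; apply/eqP/setP => x; rewrite !inE.
    by apply/negP => /andP[/eqP xi /eqP xj]; rewrite -xi -xj eqxx in nij.
  + apply/imsetP => -[i _]; have [x xi] := col_surj i.
    by move=> /setP /(_ x); rewrite !inE xi eqxx.
- by rewrite card_imset // card_ord.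
- by move=> _ /imsetP[i _ ->]; exact: col_card.
- move=> _ _ /imsetP[i _ ->] /imsetP[j _ ->] nij.
  have [|x [y [xi yj xy]]] := col_edge i j; first by apply: contraNneq nij => ->.
  by exists x, y; rewrite !inE xi yj !eqxx.
Qed.

(* The union bound over the [r ^ K] choices of one cyclic shift per block: a
   block containing [n] points of [N i] avoids colour [j] for [r - n] of the [r]
   shifts, so that [c] fails for [(i, j)] with probability at most
   [prod (1 - n / r) <= exp (- M / r)]. *)
Lemma exists_shift_coloring (R : realType) r K M (I : finType)
    (N : I -> {set 'I_K * 'I_r.+1}) :
  (#|I| <= r.+1)%N -> (forall i, M <= #|N i|)%N ->
  2 * ln r.+1%:R < M%:R / r.+1%:R :> R ->
  exists c : {ffun 'I_K -> 'I_r.+1},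
    forall i j, exists2 y, y \in N i & y.2 + c y.1 = j.
Proof.
move=> cardI cardN Mlarge.
pose bad i j : {set {ffun 'I_K -> 'I_r.+1}} :=
  [set c : {ffun 'I_K -> 'I_r.+1} | [forall y in N i, y.2 + c y.1 != j]].
have [c c_good|all_bad] := pickP (fun c => [forall i, forall j, c \notin bad i j]).
  exists c => i j; move/forallP: c_good => /(_ i) /forallP /(_ j).
  rewrite inE negb_forall => /existsP[y]; rewrite negb_imply negbK => /andP[yN /eqP].
  by exists y.
exfalso.
have bad_card i j : #|bad i j|%:R <= r.+1%:R ^+ K * expR (- (M%:R / r.+1%:R)) :> R.
  pose n b := #|[set x | (b, x) \in N i]|.
  have sum_n : (\sum_b n b = #|N i|)%N.
    rewrite -sum1_card (eq_bigl (fun y => (y.1, y.2) \in N i)); last by case.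
    rewrite -(pair_big_dep xpredT (fun b x => (b, x) \in N i) (fun _ _ => 1%N)) /=.
    by apply: eq_bigr => b _; rewrite /n -sum1_card; apply: eq_bigl => x; rewrite inE.
  (* The shifts of block [b] that give colour [j] to some point of [N i]; a bad [c] avoids [hit b]
     in every block. *)
  pose hit b := [set j - x | x in [set x | (b, x) \in N i]].
  have card_hit b : #|hit b| = n b.
    by rewrite card_imset // => x x' /(congr1 (fun u => j - u)); rewrite !subKr.
  have : (#|bad i j| <= \prod_b (r.+1 - n b))%N.
    have -> : (\prod_b (r.+1 - n b) = #|family (fun b => mem (~: hit b))|)%N.
      rewrite card_family foldrE big_map big_enum /=; apply: eq_bigr => b _.
      by rewrite (@eq_card _ _ (mem (~: hit b))) // cardsCs setCK card_hit card_ord.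
    apply: subset_leq_card; apply/subsetP => c; rewrite inE => /forallP c_bad.
    apply/familyP => b; rewrite !inE; apply/imsetP => -[x]; rewrite inE => xN cx.
    by have := c_bad (b, x); rewrite xN /= cx addrC subrK eqxx.
  rewrite -(ler_nat R) natr_prod => /le_trans; apply.
  have -> : r.+1%:R ^+ K = \prod_(b < K) r.+1%:R :> R.
    by rewrite prodr_const card_ord.
  have {}cardN : expR (- (#|N i|%:R / r.+1%:R)) <= expR (- (M%:R / r.+1%:R)) :> R.
    by rewrite ler_expR lerN2 ler_pM2r ?invr_gt0 ?ltr0n // ler_nat.
  apply: le_trans (ler_wpM2l _ cardN); last by rewrite prodr_ge0.
  have -> : - (#|N i|%:R / r.+1%:R) = \sum_b - ((n b)%:R / r.+1%:R) :> R.
    by rewrite -sum_n natr_sum mulr_suml sumrN.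
  rewrite expR_sum -big_split /=; apply: ler_prod => b _.
  rewrite ler0n /=; have nb : (n b <= r.+1)%N by rewrite -[X in (_ <= X)%N]card_ord max_card.
  rewrite natrB //.
  have -> : r.+1%:R - (n b)%:R = r.+1%:R * (1 + - ((n b)%:R / r.+1%:R)) :> R.
    by rewrite mulrDr mulr1 mulrN mulrCA divff ?pnatr_eq0 // mulr1.
  by rewrite ler_wpM2l // expR_ge1Dx.
(* Every colouring is bad for some pair, and there are at most (r+1)^2 pairs; [Mlarge] says exactly
   that (r+1)^2 exp(-M/(r+1)) < 1. *)
have : (r.+1 ^ K <= \sum_i \sum_j #|bad i j|)%N.
  rewrite -{1}[r.+1]card_ord -{1}[K]card_ord -card_ffun pair_big /= -sum1_card.
  rewrite (eq_bigr (fun ij => \sum_(c in bad ij.1 ij.2) 1)%N); last first.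
    by move=> ij _; rewrite sum1_card.
  rewrite (exchange_big_dep xpredT) //=; apply: leq_sum => c _.
  have /negbT := all_bad c; rewrite negb_forall => /existsP[i].
  rewrite negb_forall => /existsP[j]; rewrite negbK => cij.
  by rewrite (bigD1 (i, j)) //=.
apply/negP; rewrite -ltnNge -(ltr_nat R) natr_sum.
apply: (@le_lt_trans _ _ (r.+1%:R * (r.+1%:R * (r.+1%:R ^+ K * expR (- (M%:R / r.+1%:R)))))).
  apply: (@le_trans _ _ (\sum_(i : I) r.+1%:R * (r.+1%:R ^+ K * expR (- (M%:R / r.+1%:R))))).
    apply: ler_sum => i _; rewrite natr_sum.
    apply: le_trans (ler_sum _ (fun j _ => bad_card i j)) _.
    by rewrite sumr_const card_ord [leRHS]mulr_natl.
  rewrite sumr_const -[leLHS]mulr_natl ler_wpM2r ?ler_nat //.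
  by rewrite !mulr_ge0 ?exprn_ge0 ?expR_ge0.
rewrite natrX; set P := r.+1%:R ^+ K; set e := expR _; set a : R := r.+1%:R.
rewrite (_ : a * (a * (P * e)) = P * (a * a * e)); last by ring.
rewrite -[ltRHS]mulr1 ltr_pM2l ?exprn_gt0 ?ltr0n //.
have r0 : (r.+1%:R : R) \is Num.pos by rewrite posrE ltr0n.
rewrite -[a]lnK /e // -!expRD -[X in _ < X]expR0 ltr_expR.
by move: Mlarge; rewrite -/a; move: (ln a) (M%:R / a) => u v; lra.
Qed.

Lemma exists_injection (A B : finType) :
  (#|A| <= #|B|)%N -> exists g : A -> B, injective g.
Proof.
move=> le_AB; exists (fun a => enum_val (widen_ord le_AB (enum_rank a))).
by move=> a b /enum_val_inj /(congr1 val) /= /ord_inj /enum_rank_inj.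
Qed.

(** The points come already split into parts of size [k]. The lines are placed injectively into [K]
    blocks of [#|I|] slots; a cyclic shift uses each colour once per block, so each part receives at
    most [K] lines. Parts [i] and [j] are joined by a point of [i] and a line of colour [j]. *)
Lemma bip_rk_graph (R : realType) (I L : finType) k K M (inc : I * 'I_k -> L -> bool) :
  (0 < k)%N -> (0 < #|I|)%N -> (#|L| <= K * #|I|)%N ->
  (forall i, M <= #|[set y | [exists a, inc (i, a) y]]|)%N ->
  2 * ln #|I|%:R < M%:R / #|I|%:R :> R ->
  rk_graph #|I| (k + K) (bip inc).
Proof.
move=> k0 I0 cardL Mnbr Mlarge.
have [r Ir] : exists r, #|I| = r.+1 by exists #|I|.-1; rewrite prednK.
rewrite Ir in cardL Mlarge.
have [slot slot_inj] : exists g : L -> 'I_K * 'I_r.+1, injective g.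
  by apply: exists_injection; rewrite card_prod !card_ord.
pose N i := slot @: [set y | [exists a, inc (i, a) y]].
have [|i|c c_good] := @exists_shift_coloring R r K M I N _ _ Mlarge.
- by rewrite Ir.
- by rewrite card_imset.
pose rank (i : I) : 'I_r.+1 := cast_ord Ir (enum_rank i).
have rank_inj : injective rank by move=> i j /cast_ord_inj /enum_rank_inj.
have rank_surj j : exists i, rank i = j.
  by exists (enum_val (cast_ord (esym Ir) j)); rewrite /rank enum_valK cast_ordKV.
pose col (v : bip inc) : 'I_r.+1 :=
  match v with inl p => rank p.1 | inr y => (slot y).2 + c (slot y).1 end.
rewrite Ir; apply: (@coloring_rk_graph _ _ _ col).
- by move=> j; have [i <-] := rank_surj j; exists (inl (i, Ordinal k0)).
- move=> j.
  pose place (v : bip inc) : 'I_k + 'I_K :=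
    match v with inl p => inl p.2 | inr y => inr (slot y).1 end.
  rewrite -(@card_in_imset _ _ place).
    by apply: leq_trans (max_card _) _; rewrite card_sum !card_ord.
  move=> [[i a]|y] [[i' a']|y'] //; rewrite !inE /= => /eqP cj /eqP cj' [].
    by move=> ->; rewrite (rank_inj i i') // cj cj'.
  move=> e1; congr inr; apply: slot_inj.
  move: cj'; rewrite -cj -e1 => /addIr; move: e1.
  by case: (slot y) (slot y') => [? ?] [? ?] /= -> ->.
- move=> i j _; have [i' <-] := rank_surj i.
  have [_ /imsetP[y + ->] yj] := c_good i' j.
  by rewrite inE => /existsP[a iay]; exists (inl (i', a)), (inr y).
Qed.

(** * Coset graphs *)

(* [X] and [Y] stand for the right multiplications by the elements of two
   subgroups isomorphic to [F], and [phi], [psi] for homomorphisms to [F]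
   detecting them; the orbits of [X] and [Y], that is the left cosets of these
   subgroups, are represented by the kernels of [phi] and [psi]. *)
Section CosetGraph.
Variables (F : finZmodType) (T : finType).
Variables (X Y : F -> T -> T) (phi psi : T -> F).
Hypothesis X0 : forall e, X 0 e = e.
Hypothesis Y0 : forall e, Y 0 e = e.
Hypothesis XD : forall a b e, X a (X b e) = X (a + b) e.
Hypothesis YD : forall a b e, Y a (Y b e) = Y (a + b) e.
Hypothesis phiX : forall a e, phi (X a e) = phi e + a.
Hypothesis phiY : forall a e, phi (Y a e) = phi e.
Hypothesis psiX : forall a e, psi (X a e) = psi e.
Hypothesis psiY : forall a e, psi (Y a e) = psi e + a.

Let X_inj a : injective (X a).
Proof. by apply: (@can_inj _ _ _ (X (- a))) => e; rewrite XD addNr X0. Qed.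

Let Y_inj a : injective (Y a).
Proof. by apply: (@can_inj _ _ _ (Y (- a))) => e; rewrite YD addNr Y0. Qed.

Definition coset_point e := X (- phi e) e.
Definition coset_line e := Y (- psi e) e.
Definition kernel : {set T} := [set e | (phi e == 0) && (psi e == 0)].

Lemma coset_point_eq e e' : coset_point e = coset_point e' -> exists a, e' = X a e.
Proof.
move=> /(congr1 (X (phi e'))); rewrite /coset_point !XD subrr X0 => <-.
by eexists.
Qed.

Lemma coset_line_eq e e' : coset_line e = coset_line e' -> exists a, e' = Y a e.
Proof.
move=> /(congr1 (Y (psi e'))); rewrite /coset_line !YD subrr Y0 => <-.
by eexists.
Qed.

Local Notation line := {e : T | psi e == 0}.

Lemma card_line : (#|{: line}| <= #|F| * #|kernel|)%N.
Proof.
pose g (y : line) := (phi (val y), coset_point (val y)).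
have g_inj : injective g.
  move=> y y' [e1 e2]; apply: val_inj.
  by move: e2; rewrite /coset_point e1 => /X_inj.
rewrite -(card_imset _ g_inj) -[#|F|]cardsT -cardsX subset_leq_card //.
apply/subsetP => _ /imsetP[y _ ->]; rewrite !inE /= /coset_point.
by rewrite phiX psiX subrr eqxx (eqP (valP y)) eqxx.
Qed.

Section Parts.
Variables (c k : nat) (e0 : T).

(** The part [(b, j)] is the [j]-th run of [k] elements in the enumeration of [kernel], moved to the
    fibre [psi = b]. Points of one part thus share their value of [psi]; when [c * k < #|kernel|]
    the leftover points are dropped. *)
Definition part_point (p : F * 'I_c * 'I_k) : T :=
  Y p.1.1 (nth e0 (enum kernel) (p.1.2 * k + p.2)).

Definition coset_inc (p : F * 'I_c * 'I_k) (y : line) : bool :=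
  [exists e, (coset_point e == part_point p) && (coset_line e == val y)].

Hypothesis ck : (c * k <= #|kernel|)%N.

Let index_lt (j : 'I_c) (a : 'I_k) : (j * k + a < #|kernel|)%N.
Proof.
apply: leq_trans ck; apply: leq_trans (_ : j.+1 * k <= _)%N.
  by rewrite mulSn addnC ltn_add2r.
by rewrite leq_mul2r ltn_ord orbT.
Qed.

Let nth_kernel (j : 'I_c) (a : 'I_k) : nth e0 (enum kernel) (j * k + a) \in kernel.
Proof. by rewrite -mem_enum mem_nth // -cardE. Qed.

Lemma phi_part_point p : phi (part_point p) = 0.
Proof. by have := nth_kernel p.1.2 p.2; rewrite inE phiY => /andP[/eqP]. Qed.

Lemma psi_part_point p : psi (part_point p) = p.1.1.
Proof.
by have := nth_kernel p.1.2 p.2; rewrite inE psiY => /andP[_ /eqP ->]; rewrite add0r.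
Qed.

Lemma part_point_inj : injective part_point.
Proof.
move=> [[b j] a] [[b' j'] a'] E.
have /= Eb : b = b' by rewrite -[b](psi_part_point (b, j, a)) E psi_part_point.
move: E; rewrite -Eb => /Y_inj /eqP; rewrite nth_uniq -?cardE ?enum_uniq //= => /eqP E.
have k0 : (0 < k)%N by apply: leq_ltn_trans (ltn_ord a).
have Ej : j = j'.
  by apply: val_inj; have := congr1 (divn^~ k) E; rewrite !divnMDl // !divn_small // !addn0.
by move: E; rewrite Ej => /addnI /val_inj ->.
Qed.

(** All elements of the cosets in one part have the same [psi], so [coset_line] shifts them by the
    same amount and is injective on them. Hence the [k * #|F|] incidences of the part give distinct
    lines. *)
Lemma card_coset_inc i :
  (k * #|F| <= #|[set y | [exists a, coset_inc (i, a) y]]|)%N.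
Proof.
have line_psi e : psi (coset_line e) == 0 by rewrite psiY subrr.
pose g (u : 'I_k * F) : line := 
  exist (fun e => psi e == 0) _ (line_psi (X u.2 (part_point (i, u.1)))).
have g_inj : injective g.
  move=> [a x] [a' x'] /(congr1 val) /=.
  rewrite /coset_line !psiX !psi_part_point /= => /Y_inj E.
  have Ex : x = x'.
    by have := congr1 phi E; rewrite !phiX !phi_part_point !add0r.
  by move: E; rewrite Ex => /X_inj /part_point_inj [->].
have -> : (k * #|F| = #|{: 'I_k * F}|)%N by rewrite card_prod card_ord.
rewrite -cardsT -(card_imset _ g_inj) subset_leq_card //.
apply/subsetP => _ /imsetP[[a x] _ ->]; rewrite inE; apply/existsP; exists a.
apply/existsP; exists (X x (part_point (i, a))); rewrite eqxx andbT.
by rewrite /coset_point phiX phi_part_point add0r XD addNr X0.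
Qed.

Lemma coset_inc_cycle l : (2 <= l)%N ->
  contains (bip coset_inc) (cycle_graph (2 * l)) ->
  exists (e : nat -> T) (a : nat -> F),
    [/\ forall i, a i != 0,
        forall i, e i.+1 = (if odd i then X else Y) (a i) (e i)
      & e (2 * l)%N = e 0%N].
Proof.
move=> l2 /(bip_cycle l2) [p [y [py p'y pp yy [pl yl]]]].
pose ed p (y : {e : T | psi e == 0}) := odflt e0
  [pick e | (coset_point e == part_point p) && (coset_line e == val y)].
have edP p' y' : coset_inc p' y' ->
    coset_point (ed p' y') = part_point p' /\ coset_line (ed p' y') = val y'.
  move=> /existsP[e pe]; rewrite /ed; case: pickP => [e' /andP[/eqP ? /eqP ?] //|].
  by move=> /(_ e); rewrite pe.
(* [e] runs through the edges p_0 y_0, p_1 y_0, p_1 y_1, and so on, choosing an element common to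
   both cosets. Consecutive edges share a line at even [n] and a point at odd [n]. *)
pose e n := if odd n then ed (p n./2.+1) (y n./2) else ed (p n./2) (y n./2).
have step n : exists a, (a != 0) && (e n.+1 == (if odd n then X else Y) a (e n)).
  have [on|on] := boolP (odd n); rewrite /e /= on /=.
    have [p1 y1] := edP _ _ (p'y n./2); have [p2 y2] := edP _ _ (py n./2.+1).
    rewrite uphalf_half on add1n.
    have [a Ea] := coset_point_eq (etrans p1 (esym p2)).
    exists a; rewrite Ea eqxx andbT; apply: contraNneq (yy n./2) => a0.
    by apply/eqP/val_inj; rewrite -y1 -y2 Ea a0 X0.
  have [p1 y1] := edP _ _ (py n./2); have [p2 y2] := edP _ _ (p'y n./2).
  rewrite uphalf_half (negbTE on) add0n.
  have [a Ea] := coset_line_eq (etrans y1 (esym y2)).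
  exists a; rewrite Ea eqxx andbT; apply: contraNneq (pp n./2) => a0.
  by apply/eqP/part_point_inj; rewrite -p1 -p2 Ea a0 Y0.
exists e, (fun n => xchoose (step n)); split=> [n|n|].
- by case/andP: (xchooseP (step n)).
- by case/andP: (xchooseP (step n)) => _ /eqP.
- by rewrite /e mul2n odd_double doubleK pl yl.
Qed.

(** Each part holds [k] points and at most [2 * k] lines, since there are at most [#|F| * #|kernel|]
    lines for [#|F| * c] parts. *)
Lemma coset_rk_graph (R : realType) : (0 < c)%N -> (0 < k)%N ->
  (#|kernel| <= 2 * k * c)%N ->
  2 * ln (#|F| * c)%:R < (k * #|F|)%:R / (#|F| * c)%:R :> R ->
  rk_graph (#|F| * c) (3 * k) (bip coset_inc).
Proof.
move=> c0 k0 hk Mlarge.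
have cardI : #|{: F * 'I_c}| = (#|F| * c)%N by rewrite card_prod card_ord.
rewrite -cardI in Mlarge *; have -> : (3 * k = k + 2 * k)%N by lia.
apply: (bip_rk_graph _ _ _ _ Mlarge) => //.
- by rewrite cardI muln_gt0 c0 andbT; apply/card_gt0P; exists 0.
- by rewrite cardI (leq_trans card_line) // mulnCA leq_mul2l hk orbT.
- exact: card_coset_inc.
Qed.

End Parts.
End CosetGraph.

(** * The group over truncated polynomials *)

(* First row of the alternating product of [n] matrices
   [[1, a i], [0, 1]] (i even) and [[1, 0], [a i t, 1]] (i odd). *)
Fixpoint word_row (R : comNzRingType) (t : R) (a : nat -> R) n : R * R :=
  if n is n.+1 then
    let: (f, g) := word_row t a n in
    if odd n then (f + a n * t * g, g) else (f, g + a n * f)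
  else (1, 0).

Lemma word_row_morph (R S : comNzRingType) (h : {rmorphism R -> S}) t a n :
  word_row (h t) (h \o a) n = (h (word_row t a n).1, h (word_row t a n).2).
Proof.
elim: n => [|n /=]; first by rewrite /= rmorph1 rmorph0.
by move=> ->; case: (word_row t a n) => f g /=; case: odd; rewrite /= rmorphD !rmorphM.
Qed.

(** At each step the added term has strictly larger degree than the entry it is added to, so leading
    terms never cancel. *)
Lemma size_word_row (F : fieldType) (a : nat -> F) n : (forall i, a i != 0) ->
  size (word_row 'X (fun i => (a i)%:P) n).1 = n./2.+1 /\
  size (word_row 'X (fun i => (a i)%:P) n).2 = uphalf n.
Proof.
move=> a0; elim: n => [|n]; first by rewrite /= size_poly1 size_poly0.
rewrite /=; case: (word_row _ _ n) => f g /= [sf sg].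
have := uphalf_half n; case: odd; rewrite ?add1n ?add0n /= => E.
  have g0 : g != 0 by rewrite -size_poly_eq0 sg E.
  have sX : size ((a n)%:P * 'X * g) = (size g).+1.
    by rewrite -mulrA mul_polyC size_scale // mulrC size_mulX.
  by rewrite addrC size_polyDl; rewrite sX ?sf sg E.
have sC : size ((a n)%:P * f) = size f by rewrite mul_polyC size_scale.
by rewrite addrC size_polyDl; rewrite sC sf ?sg E.
Qed.

Section Model.
Variables (F : finFieldType) (s : nat).
Hypothesis s0 : (0 < s)%N.

Local Notation R := {poly %/ ('X^(s.+1) : {poly F})}.
Local Notation inR := (in_qpoly ('X^(s.+1) : {poly F})).
Local Notation t := (inR 'X).
Local Notation C a := (inR a%:P).

Definition qcoef i (x : R) : F := (x : {poly F})`_i.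

Lemma qcoef_in i f : (i <= s)%N -> qcoef i (inR f) = f`_i.
Proof.
move=> le_is; rewrite /qcoef /in_qpoly /= mk_monic_Xn /=.
rewrite [in RHS](Pdiv.RingMonic.rdivp_eq (monicXn F s.+1) f).
by rewrite coefD coefMXn ltnS le_is add0r.
Qed.

Lemma qpolyK (x : R) : inR x = x.
Proof. by apply: val_inj; apply: in_qpoly_small; apply: size_mk_monic. Qed.

Lemma qcoefD i x y : qcoef i (x + y) = qcoef i x + qcoef i y.
Proof. by rewrite /qcoef poly_of_qpolyD coefD. Qed.

Lemma qcoefM0 x y : qcoef 0 (x * y) = qcoef 0 x * qcoef 0 y.
Proof.
by rewrite -[x * y](_ : inR ((x : {poly F}) * y) = _) ?qcoef_in ?coef0M // rmorphM /= !qpolyK.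
Qed.

Lemma qcoefM1 x y :
  qcoef 1 (x * y) = qcoef 0 x * qcoef 1 y + qcoef 1 x * qcoef 0 y.
Proof.
rewrite -[x * y](_ : inR ((x : {poly F}) * y) = _); last by rewrite rmorphM /= !qpolyK.
by rewrite qcoef_in // coefM big_ord_recr big_ord1 /=.
Qed.

Lemma qcoefC0 a : qcoef 0 (C a) = a.
Proof. by rewrite qcoef_in // coefC. Qed.

Lemma qcoefX0 : qcoef 0 t = 0.
Proof. by rewrite qcoef_in // coefX. Qed.

Lemma qcoefX1 : qcoef 1 t = 1.
Proof. by rewrite qcoef_in // coefX. Qed.

Lemma qcoef_inj (x y : R) : (forall i, (i <= s)%N -> qcoef i x = qcoef i y) -> x = y.
Proof.
move=> xy; apply: val_inj; apply/polyP => i; case: (leqP i s) => [/xy //|si].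
have small (z : R) : (z : {poly F})`_i = 0.
  apply: nth_default; apply: leq_trans si; rewrite -ltnS.
  by apply: leq_trans (size_mk_monic z) _; rewrite mk_monic_Xn size_polyXn.
by rewrite !small.
Qed.

Lemma qpoly_regular (x y : R) : qcoef 0 x = 1 -> x * y = 0 -> y = 0.
Proof.
move=> x1 xy; have cop (f : {poly F}) : f`_0 = 1 -> coprimep (mk_monic 'X^(s.+1)) f.
  move=> f1; rewrite mk_monic_Xn coprimep_pexpl // coprimep_sym coprimepX.
  by rewrite rootE horner_coef0 f1 oner_eq0.
by rewrite -[y]mul1r -(qpoly_mulVz (cop _ x1)) -mulrA xy mulr0.
Qed.

(* The matrices [[p, v], [w, z]] in SL_2(F[t]/(t^(s+1))) that are upper
   unitriangular modulo [t]. *)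
Definition unip_pred (g : R * R * R * R) :=
  let: (p, v, w, z) := g in
  [&& p * z - v * w == 1, qcoef 0 p == 1 & qcoef 0 w == 0].

Local Notation T := {g | unip_pred g}.

Lemma mulX_proof a (g : T) : unip_pred
  (let: (p, v, w, z) := val g in (p, v + C a * p, w, z + C a * w)).
Proof.
case: g => -[[[p v] w] z] /= /and3P[/eqP d -> ->]; rewrite !andbT -d; apply/eqP.
by ring.
Qed.

Lemma mulY_proof b (g : T) : unip_pred
  (let: (p, v, w, z) := val g in (p + C b * t * v, v, w + C b * t * z, z)).
Proof.
case: g => -[[[p v] w] z] /= /and3P[/eqP d /eqP p1 /eqP w0].
rewrite !qcoefD !qcoefM0 qcoefX0 mulr0 !mul0r !addr0 p1 w0 !eqxx !andbT -d.
by apply/eqP; ring.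
Qed.

(** Right multiplications by [[1, a], [0, 1]] and, for [mulY], by [[1, 0], [b t, 1]]. *)
Definition mulX a (g : T) : T := exist (fun g => unip_pred g) _ (mulX_proof a g).
Definition mulY b (g : T) : T := exist (fun g => unip_pred g) _ (mulY_proof b g).
Definition entry12 (g : T) : F := qcoef 0 (val g).1.1.2.
Definition entry21 (g : T) : F := qcoef 1 (val g).1.2.

Let C0 : C 0 = 0 :> R. Proof. exact: rmorph0. Qed.
Let CD a b : C (a + b) = C a + C b :> R. Proof. by rewrite polyCD rmorphD. Qed.

Lemma mulX0 g : mulX 0 g = g.
Proof.
by apply: val_inj; case: g => -[[[p v] w] z] gP /=; rewrite C0 !mul0r !addr0.
Qed.

Lemma mulY0 g : mulY 0 g = g.
Proof.
by apply: val_inj; case: g => -[[[p v] w] z] gP /=; rewrite C0 !mul0r !addr0.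
Qed.

Lemma mulXD a b g : mulX a (mulX b g) = mulX (a + b) g.
Proof.
apply: val_inj; case: g => -[[[p v] w] z] gP /=; rewrite CD.
by congr (_, _, _, _); ring.
Qed.

Lemma mulYD a b g : mulY a (mulY b g) = mulY (a + b) g.
Proof.
apply: val_inj; case: g => -[[[p v] w] z] gP /=; rewrite CD.
by congr (_, _, _, _); ring.
Qed.

Lemma entry12_mulX a g : entry12 (mulX a g) = entry12 g + a.
Proof.
case: g => -[[[p v] w] z] gP; have /= /and3P[_ /eqP p1 _] := gP.
by rewrite /entry12 /= qcoefD qcoefM0 qcoefC0 p1 mulr1.
Qed.

Lemma entry12_mulY a g : entry12 (mulY a g) = entry12 g.
Proof. by case: g => -[[[p v] w] z]. Qed.

Lemma entry21_mulX a g : entry21 (mulX a g) = entry21 g.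
Proof. by case: g => -[[[p v] w] z]. Qed.

Lemma entry21_mulY a g : entry21 (mulY a g) = entry21 g + a.
Proof.
case: g => -[[[p v] w] z] gP; have /= /and3P[/eqP d /eqP p1 /eqP w0] := gP.
have z1 : qcoef 0 z = 1.
  have : p * z = 1 + v * w by rewrite -d subrK.
  move=> /(congr1 (qcoef 0)); rewrite qcoefD !qcoefM0 p1 w0 mul1r mulr0 addr0 => ->.
  by rewrite -(rmorph1 inR) qcoef_in // coef1.
by rewrite /entry21 /= qcoefD -mulrA qcoefM1 qcoefM0 qcoefM1 qcoefC0 qcoefX0 qcoefX1 z1; ring.
Qed.

(** With the prescribed low coefficients, [p] and [v] have [s] free coefficients each and [w] has
    [s - 1]. The determinant then fixes [z], because [p] is a unit. *)
Lemma card_kernel_le : (#|kernel entry12 entry21| <= #|F| ^ (3 * s - 1))%N.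
Proof.
pose code (g : T) : {ffun 'I_s -> F} * {ffun 'I_s -> F} * {ffun 'I_s.-1 -> F} :=
  let: (p, v, w, z) := val g in
  ([ffun i : 'I_s => qcoef i.+1 p], [ffun i : 'I_s => qcoef i.+1 v],
   [ffun i : 'I_s.-1 => qcoef i.+2 w]).
rewrite -(@card_in_imset _ _ code).
  apply: leq_trans (max_card _) _; rewrite !card_prod !card_ffun !card_ord -!expnD.
  by have -> : (3 * s - 1 = s + s + s.-1)%N by clear -s0; lia.
move=> [[[[p v] w] z] gP] [[[[p' v'] w'] z'] gP']; rewrite !inE.
have /= /and3P[/eqP d /eqP p1 /eqP w0] := gP.
have /= /and3P[/eqP d' /eqP p1' /eqP w0'] := gP'.
rewrite /entry12 /entry21 /= => /andP[/eqP v0 /eqP w1] /andP[/eqP v0' /eqP w1'].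
case=> /ffunP Ep /ffunP Ev /ffunP Ew.
have pE : p = p'.
  apply: qcoef_inj => -[|i] lti; first by rewrite p1 p1'.
  by have := Ep (Ordinal lti); rewrite !ffunE.
have vE : v = v'.
  apply: qcoef_inj => -[|i] lti; first by rewrite v0 v0'.
  by have := Ev (Ordinal lti); rewrite !ffunE.
have wE : w = w'.
  apply: qcoef_inj => -[|[|i]] lti; rewrite ?w0 ?w1 ?w0' ?w1' //.
  have lti' : (i < s.-1)%N by rewrite -ltnS prednK.
  by have := Ew (Ordinal lti'); rewrite !ffunE.
apply: val_inj; rewrite /= -pE -vE -wE; congr (_, _, _, _).
apply/eqP; rewrite -subr_eq0; apply/eqP/(qpoly_regular p1).
have dz : p * z' - v * w = 1 by rewrite pE vE wE.
by rewrite mulrBr; apply/eqP; rewrite subr_eq0; apply/eqP; apply: (addIr (- (v * w))); rewrite d dz.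
Qed.

(** The matrices [[1, c t], [0, 1]] suffice; the bound serves to fit a part size below
    [#|kernel|]. *)
Lemma card_kernel_ge : (#|F| <= #|kernel entry12 entry21|)%N.
Proof.
have gP c : unip_pred (1, C c * t, 0, 1).
  by rewrite /= mulr0 subr0 mulr1 eqxx -(rmorph1 inR) -(rmorph0 inR) !qcoef_in // coef1 coef0 !eqxx.
pose g c : T := exist (fun g => unip_pred g) _ (gP c).
have g_inj : injective g.
  move=> c c' /(congr1 (fun g : T => qcoef 1 (val g).1.1.2)) /=.
  by rewrite !qcoefM1 !qcoefC0 !qcoefX0 !qcoefX1 !mulr0 !mulr1 !addr0.
rewrite -cardsT -(card_imset _ g_inj) subset_leq_card //.
apply/subsetP => _ /imsetP[c _ ->]; rewrite !inE /entry12 /entry21 /=.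
by rewrite qcoefM0 qcoefX0 mulr0 -(rmorph0 inR) qcoef_in // coef0 !eqxx.
Qed.

(* The first row of [g0^-1 g]. *)
Definition rel_row (g0 g : T) : R * R :=
  let: (p0, v0, w0, z0) := val g0 in
  let: (p, v, w, z) := val g in
  (z0 * p - v0 * w, z0 * v - v0 * z).

Lemma rel_row_refl g : rel_row g g = (1, 0).
Proof.
case: g => -[[[p v] w] z] gP; have /= /andP[/eqP d _] := gP.
by rewrite /rel_row /= -d; congr (_, _); ring.
Qed.

Lemma rel_row_step (g0 g : T) b a :
  rel_row g0 ((if b then mulY else mulX) a g) =
  let: (f, h) := rel_row g0 g in
  if b then (f + C a * t * h, h) else (f, h + C a * f).
Proof.
case: g0 g => -[[[p0 v0] w0] z0] gP0 [[[[p v] w] z] gP].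
by case: b; rewrite /rel_row /=; congr (_, _); ring.
Qed.

(* Cut the closed walk at its midpoint: seen from [e 0], the midpoint is reached
   by two alternating products of [l] factors, one of each kind, whose first rows
   have entries of degree at most [l./2] in [t]; these degrees are different. *)
Lemma no_alternating_cycle l (e : nat -> T) (a : nat -> F) :
  (0 < l)%N -> (l./2 <= s)%N -> (forall i, a i != 0) ->
  (forall i, e i.+1 = (if odd i then mulX else mulY) (a i) (e i)) ->
  e (2 * l)%N <> e 0%N.
Proof.
move=> l0 ls a0 eS e_per.
pose row c n : R * R := word_row t (fun i => C (c i)) n.
(* The walk leaves [e 0] by a [mulY] step, which fixes the row (1, 0). So [n.+1] steps give the row
   of a word with only [n] factors, and this loss of one separates the two halves. *)
have fwd n : rel_row (e 0%N) (e n.+1) = row (fun i => a i.+1) n.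
  elim: n => [|n IH].
    rewrite eS /= (rel_row_step _ _ true) rel_row_refl /row /=.
    by rewrite mulr0 addr0.
  have -> : e n.+2 = (if odd n then mulY else mulX) (a n.+1) (e n.+1).
    by rewrite eS /=; case: odd.
  by rewrite rel_row_step IH.
(* Walked backwards, the steps are inverted, hence the signs, and the first one is a [mulX] step. *)
have bwd n : (n <= 2 * l)%N ->
    rel_row (e 0%N) (e (2 * l - n)%N) = row (fun i => - a (2 * l - i.+1)%N) n.
  elim: n => [|n IH] n2l; first by rewrite subn0 e_per rel_row_refl.
  have -> : e (2 * l - n.+1)%N =
      (if odd n then mulY else mulX) (- a (2 * l - n.+1)%N) (e (2 * l - n)%N).
    have -> : (2 * l - n = (2 * l - n.+1).+1)%N by lia.
    rewrite eS oddB // oddM /=; case: odd => /=.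
      by rewrite mulYD addNr mulY0.
    by rewrite mulXD addNr mulX0.
  by rewrite rel_row_step IH // ltnW.
pose prow c n := word_row ('X : {poly F}) (fun i => (c i)%:P) n.
have rowE c n : row c n = (inR (prow c n).1, inR (prow c n).2).
  exact: (word_row_morph inR 'X (fun i => (c i)%:P) n).
have inR_inj (f g : {poly F}) : (size f <= s.+1)%N -> (size g <= s.+1)%N ->
    inR f = inR g -> f = g.
  have small (u : {poly F}) : (size u <= s.+1)%N -> inR u = u :> {poly F}.
    by move=> su; apply: in_qpoly_small; rewrite mk_monic_Xn size_polyXn ltnS.
  by move=> /small {2}<- /small {2}<- ->.
have := bwd l (leq_pmull l (isT : 0 < 2)%N); rewrite (_ : 2 * l - l = l.-1.+1)%N; last by lia.
rewrite fwd !rowE => E.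
have [sf sg] := @size_word_row _ (fun i => a i.+1) l.-1 (fun i => a0 i.+1).
have [|sf' sg'] := @size_word_row _ (fun i => - a (2 * l - i.+1)%N) l.
  by move=> i; rewrite oppr_eq0.
have sle : (l.-1./2 <= s)%N by lia.
have sle' : (uphalf l.-1 <= s.+1)%N by rewrite uphalf_half; lia.
have sle'' : (uphalf l <= s.+1)%N by rewrite uphalf_half; lia.
have := congr1 (fun u : {poly F} => size u) (inR_inj _ _ _ _ (congr1 fst E)).
have := congr1 (fun u : {poly F} => size u) (inR_inj _ _ _ _ (congr1 snd E)).
rewrite /prow sf sf' sg sg' => /(_ sle' sle'') E2 /(_ sle ls) E1.
clear -E1 E2 l0.
(* [E1] forces [l] to be odd and [E2] forces it to be even. *)
by have := uphalf_half l; have := uphalf_half l.-1; lia.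
Qed.

End Model.

(** * Choice of the parameters *)

Lemma ln_le_2sqrt (R : realType) (x : R) : 0 < x -> ln x <= 2 * Num.sqrt x.
Proof.
move=> x0; rewrite -{1}(sqr_sqrtr (ltW x0)) lnXn ?sqrtr_gt0 // mulr2n.
by have := @ln_sublinear R (Num.sqrt x); rewrite sqrtr_gt0 => /(_ x0); lra.
Qed.

(* The choice is [k ~ sqrt (6 s h ln q)]: for [r = q (h %/ k)] it gives
   [k q / r >= k ^ 2 / h > 6 s ln q >= 2 ln r]. *)
Lemma exists_part_size (R : realType) s q h :
  (0 < s)%N -> ((48 * s) ^ 2 + 2 <= q)%N -> (q <= h)%N ->
  (h <= q ^ (3 * s - 1))%N ->
  exists k : nat, [/\ (0 < k)%N, (k <= h)%N,
    k%:R ^+ 2 <= 24 * s%:R * h%:R * ln q%:R :> R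
    & 2 * ln (q * (h %/ k))%:R < (k * q)%:R / (q * (h %/ k))%:R :> R].
Proof.
move=> s0 qs qh hq.
have q0 : 0 < q%:R :> R by rewrite ltr0n; lia.
have h0 : 0 < h%:R :> R by rewrite ltr0n; lia.
have s1 : 1 <= s%:R :> R by rewrite ler1n.
have q2 : 2 <= q%:R :> R by rewrite ler_nat; lia.
have h2 : 2 <= h%:R :> R by rewrite ler_nat; lia.
have qhR : q%:R <= h%:R :> R by rewrite ler_nat.
set L : R := ln q%:R.
have L12 : 1 / 2 <= L.
  have : ln (2 : R) <= L by rewrite ler_ln // posrE.
  have /(@le_ln1Dx R) : -1 < - 2^-1 :> R by lra.
  rewrite (_ : 1 + - 2^-1 = 2^-1 :> R); last by field.
  by rewrite lnV ?posrE ?ltr0n //; lra.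
pose T : R := 6 * s%:R * h%:R * L.
have T1 : 1 <= T.
  have : 2 <= s%:R * h%:R :> R by nra.
  rewrite (_ : T = 6 * (s%:R * h%:R) * L); last by rewrite /T; ring.
  move: (s%:R * h%:R) => u u2; nra.
have sqT : Num.sqrt T ^+ 2 = T by rewrite sqr_sqrtr //; lra.
have sqT1 : 1 <= Num.sqrt T by rewrite -[leLHS]sqrtr1 ler_sqrt //; lra.
(* As [Num.sqrt T >= 1], rounding up at most doubles it: T < k^2 <= 4 T. *)
pose k := (Num.truncn (Num.sqrt T)).+1.
have kgt : Num.sqrt T < k%:R := truncnS_gt _.
have kle : k%:R <= 2 * Num.sqrt T.
  have /andP[+ _] : (Num.truncn (Num.sqrt T))%:R <= Num.sqrt T < k%:R by rewrite truncn_itv //; lra.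
  by move=> tT; rewrite -[leLHS]natr1; lra.
have k2T : T < k%:R ^+ 2 by rewrite -sqT; nra.
have k24 : k%:R ^+ 2 <= 24 * s%:R * h%:R * L.
  have -> : 24 * s%:R * h%:R * L = 4 * T by rewrite /T; ring.
  move: kgt kle sqT sqT1; set u := Num.sqrt T => kgt kle <- u1; nra.
have k0 : 0 < k%:R :> R by rewrite ltr0n.
have kh : (k <= h)%N.
  rewrite -(ler_nat R) -(@ler_pXn2r _ 2%N) ?nnegrE //; apply: le_trans k24 _.
  (* From ln q <= 2 sqrt q and 48 s <= sqrt q, the latter being the reason for the lower bound on
     [q]. *)
  have Lq : 24 * s%:R * L <= q%:R.
    have := ln_le_2sqrt q0; rewrite -/L.
    have : 48 * s%:R <= Num.sqrt q%:R :> R.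
      rewrite -[leLHS]ger0_norm ?mulr_ge0 // -sqrtr_sqr ler_sqrt //.
      rewrite -natrM -natrX. by rewrite ler_nat (leq_trans _ qs) // leq_addr.
    have : Num.sqrt q%:R ^+ 2 = q%:R :> R by rewrite sqr_sqrtr // ltW.
    have := sqrtr_ge0 (q%:R : R); nra.
  have -> : 24 * s%:R * h%:R * L = (24 * s%:R * L) * h%:R by ring.
  by rewrite expr2 ler_pM2r //; lra.
exists k; split=> //.
set c := (h %/ k)%N.
have c0 : 0 < c%:R :> R by rewrite ltr0n divn_gt0.
have ckh : c%:R * k%:R <= h%:R :> R by rewrite -natrM ler_nat leq_trunc_div.
have -> : (k * q)%:R / (q * c)%:R = k%:R / c%:R :> R.
  by rewrite !natrM; field; rewrite !gt_eqF.
have lnr : ln (q * c)%:R <= 3 * s%:R * L.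
  have -> : 3 * s%:R * L = ln (q ^ (3 * s))%:R.
    by rewrite natrX lnXn // -/L -[RHS]mulr_natl natrM.
  rewrite ler_ln ?posrE ?ltr0n ?expn_gt0 ?muln_gt0 -?(ltr0n R) ?q0 ?c0 //.
  rewrite ler_nat; have -> : (3 * s = (3 * s - 1).+1)%N by rewrite subn1 prednK // muln_gt0.
  rewrite expnS leq_mul2l (leq_trans (leq_div _ _) hq) orbT //.
apply: (@le_lt_trans _ _ (6 * s%:R * L)); first by lra.
rewrite ltr_pdivlMr //.
have : 6 * s%:R * L * (c%:R * k%:R) < k%:R ^+ 2.
  apply: le_lt_trans k2T; rewrite /T (_ : 6 * s%:R * h%:R * L = 6 * s%:R * L * h%:R); last by ring.
  by rewrite ler_wpM2l // !mulr_ge0 //; lra.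
by rewrite expr2 mulrA ltr_pM2r.
Qed.

(** Since h <= 2 k (h %/ k), one has h q <= 2 k r, and h^2 <= q^(3l-2) because 2 (3s - 1) <= 3l - 2.
    Hence h^(3l) <= (2 k r)^(3l-2). Raising the bound on k^2 to the power 3l and cancelling k^(3l-2)
    gives k^(3l+2) <= A r^(3l-2) (ln r)^(3l); the root of order 3l + 2 of [A] is at most [A], as
    [A >= 1]. *)
Lemma part_size_bound (R : realType) l s q h k r :
  (2 <= l)%N -> (2 * s <= l)%N -> (0 < s)%N -> (3 <= q)%N -> (0 < k)%N -> (k <= h)%N ->
  (h <= q ^ (3 * s - 1))%N ->
  k%:R ^+ 2 <= 24 * s%:R * h%:R * ln q%:R :> R ->
  r = (q * (h %/ k))%N ->
  k%:R <= (24 * s%:R) ^+ (3 * l) * 2 ^+ (3 * l - 2) * r%:R `^ ((3 * l%:R - 2) / (3 * l%:R + 2))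
          * ln r%:R `^ (3 * l%:R / (3 * l%:R + 2)) :> R.
Proof.
move=> l2 sl s0 q3 k0 kh hq k2 rE.
have c0 : (0 < h %/ k)%N by rewrite divn_gt0.
have qr : (q <= r)%N by rewrite rE leq_pmulr.
have hqr : (h * q <= 2 * k * r)%N.
  rewrite rE; have := divn_eq h k; have := ltn_pmod h k0; move: (h %/ k)%N c0; nia.
have kR : 0 < k%:R :> R by rewrite ltr0n.
have rR : 0 < r%:R :> R by rewrite ltr0n; lia.
have s1 : 1 <= s%:R :> R by rewrite ler1n.
have L0 : 0 <= ln q%:R :> R by rewrite ln_ge0 // ler1n; lia.
have Lr : ln q%:R <= ln r%:R :> R.
  by rewrite ler_ln ?posrE ?ltr0n ?ler_nat //; lia.
have Lr0 : 0 <= ln r%:R :> R by lra.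
set A : R := (24 * s%:R) ^+ (3 * l) * 2 ^+ (3 * l - 2).
have A1 : 1 <= A.
  by rewrite /A mulr_ege1 // exprn_ege1 //; lra.
have main : k%:R ^+ (3 * l + 2) <= A * r%:R ^+ (3 * l - 2) * ln r%:R ^+ (3 * l) :> R.
  have h2 : (h ^ 2 <= q ^ (3 * l - 2))%N.
    apply: leq_trans (leq_pexp2l _ (_ : (3 * s - 1) * 2 <= _)%N); last 2 first.
    - by clear -q3; lia.
    - by clear -sl s0; lia.
    by rewrite expnM leq_exp2r.
  have h3 : (h ^ (3 * l) <= (2 * k * r) ^ (3 * l - 2))%N.
    apply: (@leq_trans ((h * q) ^ (3 * l - 2))); last by rewrite leq_exp2r //; clear -l2; lia.
    rewrite expnMn {1}(_ : 3 * l = (3 * l - 2) + 2)%N; last by clear -l2; lia.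
    by rewrite expnD leq_mul2l h2 orbT.
  rewrite -(ler_pM2l (exprn_gt0 (3 * l - 2) kR)) -exprD.
  have -> : (3 * l - 2 + (3 * l + 2) = 2 * (3 * l))%N by clear -l2; lia.
  rewrite exprM; apply: (@le_trans _ _ ((24 * s%:R * h%:R * ln q%:R) ^+ (3 * l))).
    by apply: lerXn2r k2; rewrite nnegrE ?exprn_ge0 // !mulr_ge0 //; lra.
  rewrite !exprMn; move: h3; rewrite -(ler_nat R) !natrX !natrM !exprMn => h3.
  apply: (@le_trans _ _ (24 ^+ (3 * l) * s%:R ^+ (3 * l) *
      (2 ^+ (3 * l - 2) * k%:R ^+ (3 * l - 2) * r%:R ^+ (3 * l - 2)) *
      ln r%:R ^+ (3 * l))).
    apply: ler_pM => //; rewrite ?mulr_ge0 ?exprn_ge0 //.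
      by rewrite ler_wpM2l // mulr_ge0 ?exprn_ge0.
    by apply: lerXn2r.
  by rewrite /A exprMn le_eqVlt; apply/orP; left; apply/eqP; ring.
clearbody A.
set D : R := 3 * l%:R + 2.
have D0 : 0 < D by rewrite /D; have := ler0n R l; lra.
have DE : D = (3 * l + 2)%:R by rewrite /D natrD natrM.
have pw (x : R) n : 0 <= x -> (x ^+ n) `^ D^-1 = x `^ (n%:R / D).
  by move=> x0; rewrite -powR_mulrn // -powRrM.
apply: (@le_trans _ _ ((k%:R ^+ (3 * l + 2)) `^ D^-1)).
  by rewrite pw ?(ltW kR) // -DE divff ?gt_eqF // powRr1 // ltW.
apply: (@le_trans _ _ ((A * r%:R ^+ (3 * l - 2) * ln r%:R ^+ (3 * l)) `^ D^-1)).
  apply: ge0_ler_powR => //; rewrite ?nnegrE ?exprn_ge0 //.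
  - by rewrite invr_ge0 ltW.
  - by rewrite !mulr_ge0 ?exprn_ge0 //; lra.
rewrite !powRM ?mulr_ge0 ?exprn_ge0 //; try lra.
rewrite !pw //.
have -> : (3 * l - 2)%:R = 3 * l%:R - 2 :> R by rewrite natrB ?natrM //; lia.
rewrite natrM -!mulrA ler_wpM2r ?mulr_ge0 ?powR_ge0 //.
have : A `^ D^-1 <= A `^ 1.
  rewrite ler_powR // invf_le1 // /D; have := ler0n R l; lra.
by rewrite powRr1 //; lra.
Qed.

(** * Upper bounds on [f] for even cycles *)

Lemma f_cycle_le (R : realType) (F : finFieldType) l k
    (h := #|kernel (@entry12 F l./2) (@entry21 F l./2)|) :
  (2 <= l)%N -> (0 < k <= h)%N ->
  2 * ln (#|F| * (h %/ k))%:R < (k * #|F|)%:R / (#|F| * (h %/ k))%:R :> R ->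
  (f (#|F| * (h %/ k)) (cycle_graph (2 * l)) <= 3 * k)%N.
Proof.
move=> l2 /andP[k0 kh] Mlarge.
have s0 : (0 < l./2)%N by rewrite half_gt0.
have F0 : (0 < #|F|)%N by apply/card_gt0P; exists 0.
have c0 : (0 < h %/ k)%N by rewrite divn_gt0.
have ck : (h %/ k * k <= h)%N := leq_trunc_div _ _.
have [e0 _] : exists e0, e0 \in kernel (@entry12 F l./2) (@entry21 F l./2).
  by apply/card_gt0P; apply: leq_trans kh.
have r0 : (0 < #|F| * (h %/ k))%N by rewrite muln_gt0 F0.
have l4 : (2 < 2 * l)%N by apply: (@leq_trans (2 * 2)); rewrite // leq_mul2l.
have [_ fmin] := fP r0 l4; apply: fmin; split; first by rewrite muln_gt0.
exists (bip (coset_inc (@mulX F l./2) (@mulY F l./2) (@entry12 F l./2) (psi := @entry21 F l./2)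
  (c := h %/ k) (k := k) e0)); split.
  apply: (coset_rk_graph (@mulX0 _ _) (@mulY0 _ _) (@mulXD _ _) (@mulYD _ _)
    (@entry12_mulX _ _) (@entry12_mulY _ _) (@entry21_mulX _ _)
    (entry21_mulY s0) e0 ck c0 k0 _ Mlarge).
  have := divn_eq h k; have := ltn_pmod h k0; rewrite -/h; clearbody h; clear -c0.
  by move: (h %/ k)%N c0 => c; nia.
move=> /(coset_inc_cycle (@mulX0 _ _) (@mulY0 _ _) (@mulXD _ _) (@mulYD _ _)
  (entry21_mulY s0) ck l2) [e [a [a0 eS]]].
exact: (no_alternating_cycle s0 (ltnW l2) (leqnn _) a0 eS).
Qed.

(** The factor 3 comes from the part size [3 * k]; [q <= r] lets [r] grow without bound with the
    prime. *)
Lemma f_cycle_bound (R : realType) l q :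
  (2 <= l)%N -> prime q -> ((48 * l./2) ^ 2 + 2 <= q)%N ->
  exists2 r : nat, (q <= r)%N &
    (f r (cycle_graph (2 * l)))%:R <=
      3 * ((24 * (l./2)%:R) ^+ (3 * l) * 2 ^+ (3 * l - 2)) *
      r%:R `^ ((3 * l%:R - 2) / (3 * l%:R + 2)) *
      ln r%:R `^ (3 * l%:R / (3 * l%:R + 2)) :> R.
Proof.
move=> l2 q_pr ql.
have s0 : (0 < l./2)%N by rewrite half_gt0.
have sl : (2 * l./2 <= l)%N by rewrite mul2n -{2}[l]odd_double_half leq_addl.
have q3 : (3 <= q)%N.
  by apply: leq_trans ql; rewrite addn2 !ltnS expn_gt0 muln_gt0 s0.
have := card_kernel_ge 'F_q s0; have := card_kernel_le 'F_q s0.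
have := @f_cycle_le R 'F_q l; rewrite !(card_Fp q_pr).
move: #|kernel _ _| => h fle hle hge.
have [k [k0 kh k2 Mlarge]] := exists_part_size R s0 ql hge hle.
exists (q * (h %/ k))%N; first by rewrite leq_pmulr // divn_gt0.
have kb := part_size_bound l2 sl s0 q3 k0 kh hle k2 erefl.
apply: (@le_trans _ _ (3 * k)%:R); first by rewrite ler_nat fle // k0.
by rewrite natrM -!mulrA ler_wpM2l // !mulrA.
Qed.

From mathcomp Require Import classical_sets cardinality.
Local Open Scope classical_set_scope.

Theorem theorem1p6 (R : realType) (l : nat) (hl : (2 <= l)%N) :
  exists C : R, 0 < C /\
    infinite_set [set r : nat | (0 < r)%N /\
      (f r (cycle_graph (2 * l)))%:R <=
        C * r%:R `^ ((3 * l%:R - 2) / (3 * l%:R + 2))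
          * ln r%:R `^ (3 * l%:R / (3 * l%:R + 2))].
Proof.
have s0 : (0 < l./2)%N by rewrite half_gt0.
exists (3 * ((24 * (l./2)%:R) ^+ (3 * l) * 2 ^+ (3 * l - 2))); split.
  by rewrite !mulr_gt0 ?exprn_gt0 ?mulr_gt0 ?ltr0n.
move=> /finite_seqP[rs rsE].
(* The prime exceeds both the threshold of [f_cycle_bound] and every entry of [rs], so the resulting
   [r >= q] cannot be listed. *)
have [q q_large q_prime] := prime_above ((48 * l./2) ^ 2 + 1 + \max_(r <- rs) r).
have [|r qr fr] := @f_cycle_bound R l q hl q_prime.
  by rewrite addn2; apply: leq_ltn_trans q_large; rewrite addn1 leq_addr.
have : r \in rs.
  have : [set` rs] r; last by [].
  by rewrite -rsE; split=> //; apply: leq_trans qr; apply: prime_gt0.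
move=> /(@leq_bigmax_seq _ _ xpredT id) /(_ isT) /(leq_trans qr).
by rewrite leqNgt (leq_ltn_trans _ q_large) // leq_addl.
Qed.
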